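(* In a game with incomplete information as described in the context, suppose Assumptions (P'), (I) and (RD) hold. Then every mixed strategy profile $g$ with each $g_i$ $\mathcal F_i$-measurable has an undistinguishable purification $f$ with each $f_i$ $\mathcal T_i$-measurable; that is, $f$ is a pure strategy profile such that $f$ and $g$ are universally distribution equivalent, universally payoff equivalent, and $f$ is belief consistent with $g$.
   Context: Game with incomplete information: players $I=\{1,\dots,n\}$. Each player $i$ has an action space $A_i$, a compact metric space; $A=\prod_{i\in I}A_i$ with Borel $\sigma$-algebra $\mathcal B(A)$. Each player $i$ has an information space $(T_i,\mathcal T_i,\lambda_i)$, an atomless probability space with $\lambda_i$ complete and countably additive; $T=\prod_i T_i$, $\mathcal T=\bigotimes_i\mathcal T_i$, and $\lambda$ is a probability measure on $(T,\mathcal T)$ whose marginal on $T_i$ is $\lambda_i$. For each $i$, $\mathcal F_i\subseteq\mathcal T_i$ is a sub-$\sigma$-algebra. Player $i$ has a payoff function $u_i:A\times T_i\to\mathbb R$. $\mathcal M(A_i)$ denotes the space of Borel probability measures on $A_i$ with the topology of weak convergence. A mixed strategy of $i$ is a measurable map $f_i:T_i\to\mathcal M(A_i)$ (write $f_i(t_i,\cdot)$ for the measure); a pure strategy is a measurable map $f_i:T_i\to A_i$, identified with $t_i\mapsto\delta_{f_i(t_i)}$. For a strategy profile $f=(f_1,\dots,f_n)$ and $E\in\mathcal T_i$, $U_i^E(f)=\int_{E\times\prod_{j\ne i}T_j}\int_A u_i(a_1,\dots,a_n,t_i)\prod_{j\in I}f_j(t_j,\mathrm d a_j)\,\mathrm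 d\lambda(t)$. Assumption (I): $\lambda=\bigotimes_{i\in I}\lambda_i$. Assumption (P'): for each $i$, $\mathcal F_i$ is countably generated; $u_i$ is $\mathcal B(A)\otimes\mathcal F_i$-measurable; $u_i(\cdot,t_i)$ is continuous on $A$ for every $t_i$; and there is a real-valued function $h_i$ integrable on $(T_i,\mathcal F_i,\lambda_i)$ with $|u_i|\le h_i$ on $A\times T_i$. Nowhere equivalence: $\mathcal T_i$ is nowhere equivalent to $\mathcal F_i$ if for every $D\in\mathcal T_i$ with $\lambda_i(D)>0$ there is a $\mathcal T_i$-measurable $D_0\subseteq D$ such that $\lambda_i(D_0\triangle D_1)>0$ for every $D_1\in\{D\cap D':D'\in\mathcal F_i\}$. Assumption (RD): for each $i$, $\mathcal T_i$ is atomless and nowhere equivalent to $\mathcal F_i$. Universal distribution equivalence: for every $i$ and every $E\in\mathcal F_i$, $\int_E f_i(t_i,\cdot)\,\mathrm d\lambda_i=\int_E g_i(t_i,\cdot)\,\mathrm d\lambda_i$ as measures on $A_i$. Universal payoff equivalence: $U_i^E(f)=U_i^E(g)$ for every $i$ and every $E\in\mathcal F_i$. Belief consistency (for pure $f$): for every $i$, $f_i(t_i)\in\operatorname{supp}g_i(t_i)$ for $\lambda_i$-almost all $t_i$. *)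

(* Defs.v *)
From HB Require Import structures.
From mathcomp Require Import all_boot all_order all_algebra.
From mathcomp Require Import all_classical all_reals all_analysis.
Set Implicit Arguments. Unset Strict Implicit. Unset Printing Implicit Defensive.
Import Order.TTheory GRing.Theory Num.Theory.
Local Open Scope classical_set_scope.
Local Open Scope ring_scope.

Definition borel (X : topologicalType) := g_sigma_algebraType (@open X).

Definition with_salg (X : pointedType) (F : set (set X)) : measurableType F.-sigma :=
  g_sigma_algebraType F.

Section defs.
Context {R : realType} {n : nat}.
Local Open Scope ereal_scope.

Definition is_product_measure {X : 'I_n -> pointedType}
  (measX : forall i, set (set (X i)))
  (mu : set (forall i, X i) -> \bar R) (mus : forall i, set (X i) -> \bar R) :=
  forall B : forall i, set (X i), (forall i, measX i (B i)) ->
    mu [set x | forall i, B i (x i)] = \prod_(i < n) mus i (B i).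

Definition rectangles {X : 'I_n -> pointedType} (measX : forall i, set (set (X i)))
  : set (set (forall i, X i)) :=
  [set Y | exists B : forall i, set (X i),
     (forall i, measX i (B i)) /\ Y = [set x | forall i, B i (x i)]].

End defs.

Section game.
Context {R : realType}.
Local Open Scope ereal_scope.

Definition complete_measure d (X : measurableType d) (mu : set X -> \bar R) :=
  forall N : set X, mu.-negligible N -> measurable N.

Definition atomless d (X : measurableType d) (mu : set X -> \bar R) :=
  forall E : set X, measurable E -> 0 < mu E ->
    exists E0 : set X, [/\ measurable E0, E0 `<=` E & 0 < mu E0 < mu E].

Definition is_sub_sigma_algebra d (X : measurableType d) (F : set (set X)) :=
  sigma_algebra setT F /\ F `<=` measurable.

Definition countably_generated (X : Type) (F : set (set X)) :=
  exists G : nat -> set X, F = <<s range G >>.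

Definition symdiff (X : Type) (A B : set X) := (A `\` B) `|` (B `\` A).

Definition nowhere_equivalent d (X : measurableType d) (mu : set X -> \bar R)
  (F : set (set X)) :=
  forall D : set X, measurable D -> 0 < mu D ->
    exists D0 : set X, [/\ measurable D0, D0 `<=` D &
      forall D' : set X, F D' -> 0 < mu (symdiff D0 (D `&` D'))].

Definition msupp (X : ptopologicalType) (mu : set (borel X) -> \bar R) : set X :=
  [set x | forall U : set X, open U -> U x -> 0 < mu U].

Context {n : nat}.

Definition Aprod (A : 'I_n -> pseudoPMetricType R) :=
  prod_topology (fun i => (A i : ptopologicalType)).

Definition Tprod (dT : 'I_n -> measure_display) (T : forall i, measurableType (dT i)) :=
  with_salg (rectangles (fun i => @measurable _ (T i))).

Definition prodP (A : 'I_n -> pseudoPMetricType R)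
  (mus : forall i, probability (borel (A i)) R) : probability (borel (Aprod A)) R :=
  get [set P : probability (borel (Aprod A)) R |
        is_product_measure (fun i => @measurable _ (borel (A i))) P (fun i => mus i)].

Definition pure_as_mixed (A : 'I_n -> pseudoPMetricType R)
  (dT : 'I_n -> measure_display) (T : forall i, measurableType (dT i))
  (f : forall i, T i -> A i) : forall i, T i -> probability (borel (A i)) R :=
  fun i t => dirac (f i t : borel (A i)).

Definition payoff (A : 'I_n -> pseudoPMetricType R)
  (dT : 'I_n -> measure_display) (T : forall i, measurableType (dT i))
  (lam : probability (Tprod T) R) (u : forall i, Aprod A -> T i -> R)
  (i : 'I_n) (E : set (T i)) (f : forall j, T j -> probability (borel (A j)) R) : \bar R :=
  \int[lam]_(t in [set t : Tprod T | E (t i)])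
     \int[prodP (fun j => f j (t j))]_a (u i a (t i))%:E.

Definition univ_distribution_equivalent (A : 'I_n -> pseudoPMetricType R)
  (dT : 'I_n -> measure_display) (T : forall i, measurableType (dT i))
  (lam_ : forall i, probability (T i) R) (F : forall i, set (set (T i)))
  (f g : forall j, T j -> probability (borel (A j)) R) :=
  forall i (E : set (T i)), F i E -> forall B : set (borel (A i)), measurable B ->
    \int[lam_ i]_(t in E) f i t B = \int[lam_ i]_(t in E) g i t B.

Definition univ_payoff_equivalent (A : 'I_n -> pseudoPMetricType R)
  (dT : 'I_n -> measure_display) (T : forall i, measurableType (dT i))
  (lam : probability (Tprod T) R) (u : forall i, Aprod A -> T i -> R)
  (F : forall i, set (set (T i)))
  (f g : forall j, T j -> probability (borel (A j)) R) :=
  forall i (E : set (T i)), F i E -> payoff lam u E f = payoff lam u E g.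

Definition belief_consistent (A : 'I_n -> pseudoPMetricType R)
  (dT : 'I_n -> measure_display) (T : forall i, measurableType (dT i))
  (lam_ : forall i, probability (T i) R)
  (f : forall j, T j -> A j) (g : forall j, T j -> probability (borel (A j)) R) :=
  forall i, {ae lam_ i, forall t, msupp (g i t) (f i t)}.

End game.

(* Main.v *)
Require Import Defs.
From HB Require Import structures.
From mathcomp Require Import all_boot all_order all_algebra.
From mathcomp Require Import all_classical all_reals all_analysis.
From mathcomp Require Import measurable_realfun.
Set Implicit Arguments. Unset Strict Implicit. Unset Printing Implicit Defensive.
Import Order.TTheory GRing.Theory Num.Theory numFieldNormedType.Exports.
Local Open Scope classical_set_scope.
Local Open Scope ring_scope.

(* For each player, nowhere equivalence says that the information space is
   relatively atomless over [F i]. By Maharam's lemma, any finite measure on [F i]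
   dominated by [E |-> lam (E `&` D)] then has the form [E |-> lam (E `&` D')] with
   [D' `<=` D]. Splitting repeatedly, the binary tree of cells cut out of the action
   space by a countable base is lifted to a tree of measurable subsets of the
   information space whose conditional probabilities given [F i] are those that
   [g i] assigns to the cells. The pure strategy sends a type to a point in the
   intersection of the closures of the cells on its branch. This gives distribution
   equivalence on open sets, hence on Borel sets. Belief consistency follows by
   integrating [g i t U] over the types with [g i t U = 0], for [U] in the base.
   For payoffs, independence factorizes the joint law of the action profile and of
   player [i]'s type over boxes, so this law is determined by the integrals that
   distribution equivalence fixes. *)

(** * Measures from set functions, densities, image measures and averages *)

Section measure_existence.
Context d (T : measurableType d) (R : realType).
Local Open Scope ereal_scope.

Lemma ex_measure (mu : set T -> \bar R) :
  mu set0 = 0 -> (forall A, 0 <= mu A) -> semi_sigma_additive mu ->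
  exists m : {measure set T -> \bar R}, forall A, m A = mu A.
Proof.
move=> h0 h1 h2; pose im := isMeasure.Build _ _ _ mu h0 h1 h2.
pose m : {measure set T -> \bar R} := HB.pack mu im.
by exists m.
Qed.

Lemma ex_finite_measure (mu : set T -> \bar R) :
  mu set0 = 0 -> (forall A, 0 <= mu A) -> semi_sigma_additive mu ->
  fin_num_fun mu ->
  exists m : {finite_measure set T -> \bar R}, forall A, m A = mu A.
Proof.
move=> h0 h1 h2 hf; pose im := isMeasure.Build _ _ _ mu h0 h1 h2.
pose m : {measure set T -> \bar R} := HB.pack mu im.
pose ifm := Measure_isFinite.Build _ _ _ m hf.
pose m' : {finite_measure set T -> \bar R} := HB.pack mu m ifm.
by exists m'.
Qed.

Lemma ex_density_measure (mu : {measure set T -> \bar R}) (phi : T -> \bar R) :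
  measurable_fun setT phi -> (forall t, 0 <= phi t) ->
  exists m : {measure set T -> \bar R}, forall E, m E = \int[mu]_(t in E) phi t.
Proof.
move=> mphi phi0; apply: ex_measure.
- by rewrite integral_set0.
- by move=> E; apply: integral_ge0.
move=> G mG tG mUG; rewrite ge0_integral_bigcup//; last first.
  exact: measurable_funS mphi.
by apply: is_cvg_ereal_nneg_natsum => n _; exact: integral_ge0.
Qed.

End measure_existence.

Lemma ex_pushforward_measure d d' (T : measurableType d) (Y : measurableType d')
    (R : realType) (f : T -> Y) (m : {measure set T -> \bar R}) :
  measurable_fun setT f ->
  exists m' : {measure set Y -> \bar R}, forall B, m' B = m (f @^-1` B).
Proof.
move=> mf; have mpre B : measurable B -> measurable (f @^-1` B).
  by move=> mB; rewrite -[X in measurable X]setTI; exact: mf.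
apply: ex_measure; [by rewrite preimage_set0 measure0|by []|].
move=> G mG tG mUG; rewrite preimage_bigcup; apply: measure_semi_sigma_additive.
- by move=> i; exact: mpre.
- apply/trivIsetP => i j _ _ ij; rewrite -preimage_setI.
  by move/trivIsetP : tG => ->//; rewrite preimage_set0.
- by rewrite -preimage_bigcup; exact: mpre.
Qed.

Section averaging.
Context d d' (T : measurableType d) (Y : measurableType d') (R : realType).
Local Open Scope ereal_scope.

Lemma ex_average_measure (mu : {measure set T -> \bar R}) (E : set T)
    (k : T -> {measure set Y -> \bar R}) :
  measurable E ->
  (forall B, measurable B -> measurable_fun setT (fun t => k t B)) ->
  exists m : {measure set Y -> \bar R}, forall B, m B = \int[mu]_(t in E) k t B.
Proof.
move=> mE mk; apply: ex_measure.
- by under eq_integral do rewrite measure0; rewrite integral0.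
- by move=> B; apply: integral_ge0.
move=> G mG tG mUG; rewrite [X in _ --> X](_ : _ =
    \int[mu]_(t in E) (\sum_(n <oo) k t (G n))); last first.
  apply: eq_integral => t _.
  by apply/esym/cvg_lim => //; exact/measure_semi_sigma_additive.
rewrite integral_nneseries//; last first.
  by move=> n; apply: measurable_funS (mk _ (mG n)).
by apply: is_cvg_ereal_nneg_natsum => n _; exact: integral_ge0.
Qed.

End averaging.

(** * Restriction to a sub-sigma-algebra *)

Section sub_salgebra.
Context d (T : measurableType d) (R : realType).
Local Open Scope ereal_scope.

Lemma measurable_with_salg (F : set (set T)) : sigma_algebra setT F ->
  measurable = F :> set (set (with_salg F)).
Proof. exact: measurable_g_measurableTypeE. Qed.

Lemma measurable_fun_with_salg d' (Y : measurableType d') (F : set (set T))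
    (f : T -> Y) : is_sub_sigma_algebra F ->
  measurable_fun setT (f : with_salg F -> Y) -> measurable_fun setT f.
Proof.
move=> [sF FT] mf _ B mB; rewrite setTI; apply: FT.
by rewrite -(measurable_with_salg sF) -[X in measurable X]setTI; exact: mf.
Qed.

Lemma sub_finite_measure (F : set (set T)) (mu : {measure set T -> \bar R}) :
  is_sub_sigma_algebra F -> mu setT < +oo ->
  exists m : {finite_measure set (with_salg F) -> \bar R},
    forall E, m E = mu E.
Proof.
move=> [sF FT] muoo.
have mE (E : set (with_salg F)) : measurable E -> measurable (E : set T).
  by rewrite measurable_with_salg// => /FT.
apply: (@ex_finite_measure _ (with_salg F)); [exact: measure0|by []| |].
  move=> G mG tG mUG; apply: measure_semi_sigma_additive => //.
    by move=> i; exact: mE.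
  exact: mE.
move=> E /mE mE'; rewrite ge0_fin_numE//; apply: le_lt_trans muoo.
by apply: le_measure; rewrite ?inE.
Qed.

End sub_salgebra.

(** * Comparison of finite measures and maximal sets *)

Section hahn.
Context d (T : measurableType d) (R : realType).
Local Open Scope ereal_scope.

(** [P] is the positive set of a Hahn decomposition for the signed measure [m1 - m2]. *)
Lemma hahn_compare (m1 m2 : {finite_measure set T -> \bar R}) :
  exists P, [/\ measurable P,
    forall E, measurable E -> E `<=` P -> m2 E <= m1 E &
    forall E, measurable E -> E `<=` ~` P -> m1 E <= m2 E].
Proof.
have [P [N [[mP posP] [mN negN] PUN PIN]]] := Hahn_decomposition
  (cadd (charge_of_finite_measure m1) (copp (charge_of_finite_measure m2))).
exists P; split => // E mE EP.
  by have := posP _ mE EP; rewrite /cadd /copp /= sube_ge0 ?fin_num_measure.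
have /(negN _ mE) : E `<=` N.
  by move=> x Ex; have : (P `|` N) x by [rewrite PUN]; move=> [/(EP _ Ex)|].
by rewrite /cadd /copp /= sube_le0.
Qed.

(** Members of [C] are chosen greedily in an increasing chain: the set at step [k + 1] comes within
    [1 / (k + 1)] of the measure of every member of [C] containing the set at step [k]. The union of
    the chain is then maximal. *)
Lemma exhaustion (mu : {finite_measure set T -> \bar R}) (C : set (set T)) :
  C `<=` measurable -> C !=set0 ->
  (forall A : nat -> set T, nondecreasing_seq A -> (forall k, C (A k)) ->
    C (\bigcup_k A k)) ->
  exists2 M, C M & forall N, C N -> M `<=` N -> mu N <= mu M.
Proof.
move=> Cm [A0 CA0] Cbig.
pose X := {A | C A}.
have step (p : nat * X) : {q : nat * X | q.1 = p.1.+1 /\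
    sval p.2 `<=` sval q.2 /\ forall B, C B -> sval p.2 `<=` B ->
      mu B <= mu (sval q.2) + (p.1.+1%:R^-1)%:E}.
  case: p => k [A CA] /=; apply: cid.
  pose S := [set mu B | B in [set B | C B /\ A `<=` B]].
  have mfin B : C B -> mu B \is a fin_num by move/Cm; exact: fin_num_measure.
  have Sfin : ereal_sup S \is a fin_num.
    rewrite fin_numElt; apply/andP; split.
      apply: (@lt_le_trans _ _ (mu A)); first by rewrite ltNye_eq mfin.
      by apply: ereal_sup_ubound; exists A => //; split.
    apply: (@le_lt_trans _ _ (mu setT)); last first.
      by rewrite ltey_eq fin_num_measure.
    apply: ge_ereal_sup => _ [B [/Cm mB _] <-].
    by apply: le_measure; rewrite ?inE.
  have e0 : (0 < k.+1%:R^-1 :> R)%R by rewrite invr_gt0.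
  have [_ [B [CB AB] <-] SB] := @ub_ereal_sup_adherent _ S _ e0 Sfin.
  exists (k.+1, exist _ B CB); split=> //; split=> //= B' CB' AB'.
  rewrite -leeBlDr//; apply: le_trans (ltW SB).
  by rewrite leeB//; apply: ereal_sup_ubound; exists B'.
have [f [f0 fS]] := dependent_choice step (0%N, exist _ A0 CA0).
have f1 k : (f k).1 = k by elim: k => [|k IH]; rewrite ?f0//; case: (fS k) => ->; rewrite IH.
pose A k := sval (f k).2.
have ndA : nondecreasing_seq A.
  by apply/nondecreasing_seqP => k; apply/subsetPset; case: (fS k) => _ [].
have CA k : C (A k) by rewrite /A; case: (f k).2.
have CM := Cbig _ ndA CA.
exists (\bigcup_k A k) => // N CN MN.
apply/lee_addgt0Pr => e e0.
have [k _ /(_ k (leqnn k)) /= ke] := near_infty_natSinv_lt (PosNum e0).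
have [_ [_ /(_ N CN)]] := fS k.
rewrite f1 => /(_ _) H; apply: (le_trans (H _)).
  by apply: subset_trans MN => x Ax; exists k.
apply: leeD; last by rewrite lee_fin ltW.
apply: le_measure; rewrite ?inE; [exact/Cm/CA|exact/Cm|].
by move=> x Ax; exists k.+1.
Qed.

End hahn.

(** * Maharam's lemma over a sub-sigma-algebra *)

Section maharam.
Context d (T : measurableType d) (R : realType) (lam : probability T R).
Variable F : set (set T).
Hypothesis HF : is_sub_sigma_algebra F.
Hypothesis Hnw : nowhere_equivalent lam F.
Local Open Scope ereal_scope.

Let mF E : F E -> measurable E. Proof. exact: HF.2. Qed.

Let FI A B : F A -> F B -> F (A `&` B).
Proof.
rewrite -(measurable_with_salg HF.1); exact: (@measurableI _ (with_salg F)).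
Qed.

Let FD A B : F A -> F B -> F (A `\` B).
Proof.
rewrite -(measurable_with_salg HF.1); exact: (@measurableD _ (with_salg F)).
Qed.

Let lamoo : lam setT < +oo. Proof. by rewrite probability_setT ltry. Qed.

Let lam_le A B : measurable A -> measurable B -> A `<=` B -> lam A <= lam B.
Proof. by move=> mA mB; apply: le_measure; rewrite ?inE. Qed.

Let lamU A B : measurable A -> measurable B -> A `&` B = set0 ->
  lam (A `|` B) = lam A + lam B.
Proof. exact: measureU. Qed.

(* Where the two halves of [D] have conditional probabilities given [F] that are
   ordered one way or the other, keep the smaller half. *)
Lemma halving (D : set T) : measurable D -> 0 < lam D ->
  exists D1, [/\ measurable D1, D1 `<=` D, 0 < lam D1 &
    forall E, F E -> lam (E `&` D1) + lam (E `&` D1) <= lam (E `&` D)].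
Proof.
move=> mD D0; have [C [mC CD HC]] := Hnw mD D0.
have mDC : measurable (D `\` C) by exact: measurableD.
have restr (B : set T) (mB : measurable B) :
    exists m : {finite_measure set (with_salg F) -> \bar R},
      forall E, m E = lam (E `&` B).
  apply: (sub_finite_measure (mu := mrestr lam mB) HF).
  by rewrite /= /mrestr setTI (le_lt_trans _ lamoo)// lam_le.
have [m1 m1E] := restr C mC; have [m2 m2E] := restr _ mDC.
have [P []] := hahn_compare m1 m2.
rewrite measurable_with_salg; last exact: HF.1.
move=> FP Ple Pge; have mP := mF FP.
pose D1 := (C `\` P) `|` ((D `\` C) `&` P).
have mD1 : measurable D1.
  by apply: measurableU; [exact: measurableD|exact: measurableI].
exists D1; split => //.
- by move=> x [[/CD]|[[]]].
(* [D1] is the symmetric difference of [C] and the trace of [P] on [D]; as [P] lies in [F], the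
   choice of [C] makes it non-null. *)
- rewrite lt0e measure_ge0 andbT; apply/eqP => D10.
  have := HC P FP.
  suff -> : symdiff C (D `&` P) = D1 by rewrite D10 ltxx.
  rewrite /symdiff /D1; apply/seteqP; split=> x.
    move=> [[Cx nDP]|[[Dx Px] nCx]]; last by right.
    by left; split=> // Px; apply: nDP; split=> //; exact: CD.
  by move=> [[Cx nP]|[[Dx nC] Px]]; [left; split=> // -[]|right].
move=> E FE; have mE := mF FE.
have -> : lam (E `&` D1) = m1 (E `\` P) + m2 (E `&` P).
  rewrite m1E m2E -measureU//; last 3 first.
  - by apply: measurableI => //; exact: measurableD.
  - by apply: measurableI => //; exact: measurableI.
  - by apply/seteqP; split=> x //; rewrite /setI/=; tauto.
  by congr (lam _); apply/seteqP; split=> x; rewrite /D1 /setI/setU/setD/=; tauto.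
have -> : lam (E `&` D) = (m1 (E `\` P) + m1 (E `&` P)) +
                          (m2 (E `\` P) + m2 (E `&` P)).
  rewrite !m1E !m2E -!measureU//; last first.
  - by apply/seteqP; split=> x //; rewrite /setI/=; tauto.
  - by apply: measurableI => //; exact: measurableI.
  - by apply: measurableI => //; exact: measurableD.
  - by apply/seteqP; split=> x //; rewrite /setI/=; tauto.
  - by apply: measurableI => //; exact: measurableI.
  - by apply: measurableI => //; exact: measurableD.
  - by apply/seteqP; split=> x //; rewrite /setI/setU/=; tauto.
  - by apply: measurableU; apply: measurableI => //; [exact: measurableD|exact: measurableI].
  - by apply: measurableU; apply: measurableI => //; [exact: measurableD|exact: measurableI].
  congr (lam _); apply/seteqP; split=> x; rewrite /setI/setU/setD/=.
    by have [] := pselect (C x); have [] := pselect (P x); tauto.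
  by have := CD x; tauto.
rewrite addeACA [leRHS]addeACA; apply: leeD.
  apply: leeD => //; apply: Pge => //.
  exact: FD.
apply: leeD => //; apply: Ple => //.
exact: FI.
Qed.

(** Each halving at least halves the conditional probability given [F], so [k] of them divide it by
    [2 ^ k] or more. *)
Lemma small_subset k (D : set T) : measurable D -> 0 < lam D ->
  exists D1, [/\ measurable D1, D1 `<=` D, 0 < lam D1 &
    forall E, F E -> (2 ^+ k)%:E * lam (E `&` D1) <= lam (E `&` D)].
Proof.
move=> mD D0; elim: k => [|k [D1 [mD1 D1D D10 HD1]]].
  by exists D; split=> // E FE; rewrite expr0 mul1e.
have [D2 [mD2 D21 D20 HD2]] := halving mD1 D10.
exists D2; split=> //; first exact: subset_trans D1D.
move=> E FE; apply: le_trans (HD1 _ FE).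
rewrite exprSr EFinM -muleA lee_pmul2l// ?lte_fin ?exprn_gt0//.
by rewrite mule_natl mule2n; exact: HD2.
Qed.

(** A maximal [M] among the subsets of [D] whose trace of [lam] stays below [m] on [F] attains
    equality: a strict inequality at some [E0] leaves room, on a part of [E0], for a further subset
    of [D] of small conditional probability. *)
Theorem maharam (m : {finite_measure set (with_salg F) -> \bar R}) (D : set T) :
  measurable D -> (forall E, F E -> m E <= lam (E `&` D)) ->
  exists D', [/\ measurable D', D' `<=` D &
    forall E, F E -> lam (E `&` D') = m E].
Proof.
move=> mD mle.
pose C := [set A | [/\ measurable A, A `<=` D &
  forall E, F E -> lam (E `&` A) <= m E]].
have [||A ndA CA|M [mM MD HM] Mmax] := @exhaustion _ T _ lam C.
- by move=> A [].
- exists set0; split => // E FE; rewrite setI0 measure0.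
  exact: measure_ge0.
- have mA k : measurable (A k) by case: (CA k).
  split; first exact: bigcupT_measurable.
    by apply: bigcup_sub => k _; case: (CA k).
  move=> E FE; rewrite setI_bigcupr.
  have ndEA : nondecreasing_seq (fun k => E `&` A k).
    by move=> i j ij; apply/subsetPset; apply: setIS; apply/subsetPset; exact: ndA.
  have cv := @nondecreasing_cvg_mu _ _ _ lam (fun k => E `&` A k)
    (fun k => measurableI _ _ (mF FE) (mA k))
    (bigcupT_measurable _ (fun k => measurableI _ _ (mF FE) (mA k))) ndEA.
  rewrite -(cvg_lim _ cv)//; apply: lime_le; first by apply/cvg_ex; eexists; exact: cv.
  by apply: nearW => k /=; case: (CA k) => _ _; exact.
exists M; split=> // E0 FE0; apply/eqP; rewrite eq_le HM//=.
rewrite leNgt; apply/negP => lt0.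
have mE0 := mF FE0.
have mfin E : F E -> m E \is a fin_num.
  by move=> FE; apply: fin_num_measure; rewrite measurable_with_salg//; exact: HF.1.
have lamfin A : measurable A -> lam A \is a fin_num by exact: fin_num_measure.
(* The defect of [M] on [E0] exceeds [1 / 2 ^ k] for [k] large. *)
have [k klt] : exists k, ((2 ^+ k)^-1)%R%:E + lam (E0 `&` M) < m E0.
  have e0 : (0 < fine (m E0) - fine (lam (E0 `&` M)))%R.
    by rewrite subr_gt0 fine_lt//; [apply: lamfin; exact: measurableI|exact: mfin].
  have [k _ /(_ k (leqnn k)) /=] := near_infty_natSinv_expn_lt (PosNum e0).
  move=> /= kl; exists k; rewrite -(fineK (mfin _ FE0)).
  rewrite -[lam _]fineK ?lamfin//; last exact: measurableI.
  by rewrite -EFinD lte_fin -ltrBrDr -div1r.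
set e : R := ((2 ^+ k)^-1)%R in klt.
have e0 : (0 <= e)%R by rewrite invr_ge0 exprn_ge0.
have [m2 m2E] : exists m2 : {finite_measure set (with_salg F) -> \bar R},
    forall E, m2 E = e%:E * lam E + lam (E `&` M).
  pose mu : {measure set T -> \bar R} :=
    measure_add (mscale (NngNum e0) lam) (mrestr lam mM).
  have muE A : mu A = e%:E * lam A + lam (A `&` M) by exact: measure_addE.
  have [|m2 m2E] := sub_finite_measure (mu := mu) HF.
    rewrite muE setTI probability_setT mule1.
    by rewrite lte_add_pinfty ?ltry// (le_lt_trans _ lamoo)// lam_le.
  by exists m2 => E; rewrite m2E muE.
(* On [P] the measure [m] is at least [m2], so there [M] can be enlarged by a set of conditional
   probability at most [e]. *)
have [P []] := hahn_compare m m2.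
rewrite measurable_with_salg; last exact: HF.1.
move=> FP Ple Pge; have mP := mF FP.
have FP0 : F (E0 `&` P) by exact: FI.
have mP0 := mF FP0.
have msplit (m' : {finite_measure set (with_salg F) -> \bar R}) E B : F E -> F B ->
    m' E = m' (E `\` B) + m' (E `&` B).
  by move=> FE FB; apply: measureDI; rewrite measurable_with_salg//; exact: HF.1.
(* Otherwise [m] would be at most [m2] on both pieces of [E0], against the choice of [k]. *)
have P0gt : lam (E0 `&` P `&` M) < m (E0 `&` P).
  rewrite ltNge; apply/negP => le1.
  move: klt; apply/negP; rewrite -leNgt.
  apply: (@le_trans _ _ (m2 E0)); last first.
    rewrite m2E leeD2r// -[leRHS]mule1 lee_wpmul2l ?lee_fin//.
    exact: probability_le1.
  rewrite (msplit m E0 P)// (msplit m2 E0 P)//; apply: leeD.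
    apply: Pge => //.
    exact: FD.
  apply: (le_trans le1); rewrite m2E leeDr// mule_ge0//.
have mDM : measurable (E0 `&` P `&` (D `\` M)).
  by apply: measurableI => //; exact: measurableD.
(* If this set were null, the domination of [m] by the trace of [lam] on [D] would contradict
   [P0gt]. *)
have pos : 0 < lam (E0 `&` P `&` (D `\` M)).
  rewrite lt0e measure_ge0 andbT; apply/eqP => null.
  have := lt_le_trans P0gt (mle _ FP0); apply/negP; rewrite -leNgt.
  rewrite -[leRHS]adde0 -null -lamU//; last 2 first.
  - exact: measurableI.
  - by apply/seteqP; split=> x //; rewrite /setI/setD/=; tauto.
  apply: lam_le; first exact: measurableI.
    by apply: measurableU => //; exact: measurableI.
  by move=> x; rewrite /setI/setU/setD/=; have [] := pselect (M x); tauto.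
have [D2 [mD2 D2s D20 HD2]] := small_subset k mDM pos.
have CN : C (M `|` D2).
  split; first exact: measurableU.
    by move=> x [/MD|/D2s [_ []]].
  move=> E FE; have mE := mF FE.
  have FEP : F (E `&` (E0 `&` P)) by exact: FI.
  have FEP' : F (E `\` (E0 `&` P)) by exact: FD.
  have d2le : lam (E `&` D2) <= e%:E * lam (E `&` (E0 `&` P)).
    rewrite -(@lee_pmul2l _ (2 ^+ k)%:E)// ?lte_fin ?exprn_gt0//.
    rewrite muleA -EFinM /e divff ?mul1e; last by rewrite expf_neq0.
    apply: (le_trans (HD2 _ FE)); apply: lam_le.
    - exact: measurableI.
    - exact: measurableI.
    - by move=> x [? []].
  rewrite setIUr lamU//; last 3 first.
  - exact: measurableI.
  - exact: measurableI.
  - by apply/seteqP; split=> x //= -[[_ Mx] [_ /D2s [_ []]]].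
  rewrite (msplit m E (E0 `&` P))//.
  have -> : lam (E `&` M) = lam ((E `\` (E0 `&` P)) `&` M) +
                           lam ((E `&` (E0 `&` P)) `&` M).
    rewrite -lamU//.
    - by congr (lam _); apply/seteqP; split=> x; rewrite /setI/setU/setD/=;
        have [] := pselect ((E0 `&` P) x); rewrite /setI/=; tauto.
    - by apply: measurableI => //; exact: mF.
    - by apply: measurableI => //; exact: mF.
    - by apply/seteqP; split=> x //; rewrite /setI/setD/=; tauto.
  rewrite -addeA; apply: leeD; first exact: HM.
  apply: (@le_trans _ _ (m2 (E `&` (E0 `&` P)))).
    by rewrite m2E addeC leeD2r.
  by apply: Ple => // x [_ []].
have : lam (M `|` D2) <= lam M by apply: Mmax => //; exact: subsetUl.
rewrite lamU//; last first.
  by apply/seteqP; split=> x //= -[Mx /D2s [_ []]].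
apply/negP; rewrite -ltNge lteDl// lamfin//.
Qed.

End maharam.

(** * Binary trees of cells and unions of cells *)

Section branch.
Context (X : Type).
Variable S : seq bool -> set X -> set X.
Hypothesis subS : forall w D, S w D `<=` D.

(* A binary tree of nested partitions: words are read from right to left, so that
   [b :: w] is a child of [w]. *)
Fixpoint branch (w : seq bool) : set X :=
  if w is b :: w' then
    if b then S w' (branch w') else branch w' `\` S w' (branch w')
  else setT.

(** Records on which side of each split [x] falls, latest split first: the only word of length [k]
    whose cell contains [x]. *)
Fixpoint address (x : X) (k : nat) : seq bool :=
  if k is k'.+1 then
    let w := address x k' in `[< S w (branch w) x >] :: w
  else [::].

Lemma size_address x k : size (address x k) = k.
Proof. by elim: k => //= k ->. Qed.

Lemma branch_address x k : branch (address x k) x.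
Proof. by elim: k => //= k IH; case: asboolP. Qed.

Lemma branch_sub b w : branch (b :: w) `<=` branch w.
Proof. by case: b => /= x; [exact: subS|case]. Qed.

Lemma address_branch x w : branch w x -> w = address x (size w).
Proof.
elim: w => // b w IH wx /=; have /IH <- := branch_sub wx.
by case: b wx => /= [?|[? ?]]; congr cons; symmetry; [exact/asboolP|exact/asboolPn].
Qed.

Lemma drop_address x i k : (i <= k)%N -> drop i (address x k) = address x (k - i).
Proof.
elim: i k => [|i IH] k; first by rewrite drop0 subn0.
by case: k => // k ik /=; rewrite IH.
Qed.

(** For [i > 0], [drop i w] runs over the proper ancestors of [w]. Keeping the words without an
    ancestor in [W] turns a union of possibly nested cells into a disjoint one. *)
Definition minimal_words (W : set (seq bool)) : set (seq bool) :=
  [set w | W w /\ forall i, (0 < i <= size w)%N -> ~ W (drop i w)].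

Lemma bigcup_minimal_words W :
  \bigcup_(w in W) branch w = \bigcup_(w in minimal_words W) branch w.
Proof.
apply/seteqP; split=> x [w Ww wx]; last by exists w => //; case: Ww.
have ex : exists k, `[< W (address x k) >].
  by exists (size w); rewrite -address_branch//; exact/asboolP.
case: (ex_minnP ex) => k /asboolP Wk mink.
exists (address x k); last exact: branch_address.
split=> // i; rewrite size_address => /andP[i0 ik].
rewrite drop_address// => /asboolP /mink; rewrite leqNgt.
by rewrite ltn_subrL i0 (leq_trans i0 ik).
Qed.

(** Words whose cells share [x] are both addresses of [x], so the shorter is a suffix of the longer;
    minimality excludes a proper suffix. *)
Lemma minimal_words_disjoint W w w' x :
  minimal_words W w -> minimal_words W w' -> branch w x -> branch w' x -> w = w'.
Proof.
wlog ww' : w w' / (size w <= size w')%N.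
  by move=> H; have [/H//|/ltnW /H {}H *] := leqP (size w) (size w'); exact/esym/H.
move=> [Ww _] [_ minw'] wx w'x.
move: ww'; rewrite leq_eqVlt => /predU1P[eqs|lts].
  by rewrite (address_branch wx) (address_branch w'x) eqs.
have := minw' (size w' - size w)%N; rewrite subn_gt0 lts leq_subr => /(_ isT).
rewrite {2}(address_branch w'x) drop_address ?leq_subr//.
by rewrite subKn ?(ltnW lts)// -address_branch.
Qed.

End branch.

Section branch_measure.
Context d (X : measurableType d) (R : realType).
Variables (S : seq bool -> set X -> set X) (mu : {measure set X -> \bar R}).
Hypothesis subS : forall w D, S w D `<=` D.
Hypothesis mB : forall w, measurable (branch S w).
Local Open Scope ereal_scope.

Lemma measurable_bigcup_branch W : measurable (\bigcup_(w in W) branch S w).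
Proof.
rewrite bigcup_mkcond; apply: countable_bigcupT_measurable => // w.
by case: ifP.
Qed.

Lemma measure_bigcup_branch W : mu (\bigcup_(w in W) branch S w) =
  \sum_(0 <= i <oo | i \in pickle @` minimal_words W)
    mu (branch S (odflt [::] (unpickle i))).
Proof.
rewrite bigcup_minimal_words//.
pose Z i := branch S (odflt [::] (unpickle i)).
rewrite (_ : \bigcup_(w in _) _ =
    \bigcup_(i in pickle @` minimal_words W) Z i); last first.
  rewrite bigcup_image; apply: eq_bigcupr => w _.
  by rewrite /Z pickleK.
rewrite measure_bigcup//; first by move=> i _; exact: mB.
move=> _ _ [w Ww <-] [w' Ww' <-] [x []]; rewrite /Z !pickleK /= => wx w'x.
by congr pickle; exact: (minimal_words_disjoint subS Ww Ww' wx w'x).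
Qed.

End branch_measure.

(** The minimal words depend on [W] alone, so both sides expand into the same series, term by
    term. *)
Lemma branch_measure_eq d d' (X : measurableType d) (Y : measurableType d')
    (R : realType) (S : seq bool -> set X -> set X) (S' : seq bool -> set Y -> set Y)
    (mu : {measure set X -> \bar R}) (nu : {measure set Y -> \bar R}) W :
  (forall w D, S w D `<=` D) -> (forall w D, S' w D `<=` D) ->
  (forall w, measurable (branch S w)) -> (forall w, measurable (branch S' w)) ->
  (forall w, mu (branch S w) = nu (branch S' w)) ->
  mu (\bigcup_(w in W) branch S w) = nu (\bigcup_(w in W) branch S' w).
Proof.
move=> subS subS' mS mS' munu; rewrite !measure_bigcup_branch//.
by apply: eq_eseriesr => i _; exact: munu.
Qed.

(** * Purification of one player's strategy *)

Lemma regular_countable_base (R : realType) (A : pseudoPMetricType R) :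
  compact [set: A] -> exists U : nat -> set A, (forall k, open (U k)) /\
    forall x V, open V -> V x -> exists k, U k x /\ closure (U k) `<=` V.
Proof.
move=> cA; have [B /countable_injP[f finj] [Bo Bb]] := compact_second_countable cA.
(* Injectivity of [f] on the base leaves at most one [V] for each [k]: the union is that base set,
   or empty. *)
exists (fun k => \bigcup_(V in [set V | B V /\ f V = k]) V); split.
  by move=> k; apply: bigcup_open => V [/Bo].
move=> x V oV Vx; have [W Wx WV] := @uniform_regular A x V (open_nbhs_nbhs (conj oV Vx)).
have [W' [BW' W'x] W'W] := Bb x W Wx.
exists (f W'); rewrite (_ : \bigcup_(V in _) V = W').
  by split=> //; apply: subset_trans WV; exact: closure_subset.
apply/seteqP; split=> [y [W'' [BW'' ff] W''y]|y W'y]; last by exists W'.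
by rewrite -(finj _ _ _ _ ff)// inE.
Qed.

Section selection.
Context d (T : measurableType d) (R : realType) (lam : probability T R).
Variable F : set (set T).
Hypothesis HF : is_sub_sigma_algebra F.
Hypothesis Hnw : nowhere_equivalent lam F.
Variable A : pseudoPMetricType R.
Hypothesis cA : compact [set: A].
Variable g : T -> probability (borel A) R.
Hypothesis mg : forall B, measurable B ->
  measurable_fun setT ((fun t => g t B) : with_salg F -> \bar R).
Local Open Scope ereal_scope.

Let mgT B : measurable B -> measurable_fun setT (fun t => g t B).
Proof. by move=> /mg; exact: measurable_fun_with_salg. Qed.

Let FT E : F E -> measurable E. Proof. exact: HF.2. Qed.

(* The inner [D `&` _] forces inclusion even when the argument of [get] is empty. *)
Let lift (S : seq bool -> set A -> set A) (w : seq bool) (D : set T) : set T :=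
  D `&` get [set D' | [/\ measurable D', D' `<=` D & forall E, F E ->
    lam (E `&` D') = \int[lam]_(t in E) g t (branch S (true :: w))]].

(** Induction on words. The integral of [g t] over the [true] child is dominated by that over the
    parent, hence by the trace of [lam] on the lifted parent, so Maharam's lemma supplies the lifted
    child. The [false] child follows by subtraction. *)
Let lift_branch (S : seq bool -> set A -> set A) :
  (forall w D, S w D `<=` D) ->
  (forall w, measurable (branch S w : set (borel A))) -> forall w,
  measurable (branch (lift S) w) /\ forall E, F E ->
    lam (branch (lift S) w `&` E) = \int[lam]_(t in E) g t (branch S w).
Proof.
move=> subS mS; elim=> [|b w [mD HD]].
  split; first exact: measurableT.
  move=> E FE /=; rewrite setTI; under eq_integral do rewrite probability_setT.
  by rewrite integral_cst ?mul1e//; exact: FT.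
pose D := branch (lift S) w.
pose C := branch S (true :: w).
have mC : measurable (C : set (borel A)) := mS (true :: w).
have CS : C `<=` branch S w by exact: subS.
have [D' [mD' D'D HD']] : exists D', [/\ measurable D', D' `<=` D & forall E, F E ->
    lam (E `&` D') = \int[lam]_(t in E) g t C].
  have [||m0 m0E] := @ex_density_measure _ _ _ lam (fun t => g t C); [exact: mgT|by []|].
  have [|m mE] := @sub_finite_measure _ _ _ F m0 HF.
    rewrite m0E (@le_lt_trans _ _ (\int[lam]_t cst 1 t))//.
      by apply: ge0_le_integral => //= [|t _]; [exact: mgT|exact: probability_le1].
    rewrite integral_cst// mul1e; apply: (@le_lt_trans _ _ 1); last exact: ltry.
    exact: probability_le1.
  have mle E : F E -> m E <= lam (E `&` D).
    move=> FE; rewrite mE m0E setIC HD//.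
    apply: ge0_le_integral => //; first exact: FT.
    - by apply: measurable_funS (mgT mC) => //; exact: measurableT.
    - by apply: measurable_funS (mgT (mS w)) => //; exact: measurableT.
    - by move=> t _; apply: le_measure; rewrite ?inE//; exact: mS.
  have [D' [mD' D'D HD']] := maharam HF Hnw mD mle.
  by exists D'; split=> // E FE; rewrite HD'// mE m0E.
(* [get] returns a solution since one exists, and intersecting it with [D] changes nothing. *)
have [mG GD HG] : [set D' | [/\ measurable D', D' `<=` D & forall E, F E ->
    lam (E `&` D') = \int[lam]_(t in E) g t C]] (lift S w D).
  rewrite /lift; set X := [set D' | _].
  have [mG GD HG] : X (get X) by apply: getPex; exists D'.
  by have -> : D `&` get X = get X by exact/setIidPr.
case: b => /=; split=> //.
- by move=> E FE; rewrite setIC HG.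
- exact: measurableD.
move=> E FE; have mE := FT FE.
have [nu nuE] := @ex_average_measure _ _ T (borel A) R lam E g mE mgT.
have nuoo : nu (branch S w) < +oo.
  by rewrite nuE -HD// (le_lt_trans (probability_le1 _ _)) ?ltry//; exact: measurableI.
have -> : (branch (lift S) w `\` lift S w D) `&` E =
    (branch (lift S) w `&` E) `\` (lift S w D `&` E).
  by apply/seteqP; split=> x; rewrite /setI/setD/=; tauto.
rewrite measureD; last 3 first.
- exact: measurableI.
- exact: measurableI.
- by rewrite (le_lt_trans (probability_le1 _ _)) ?ltry//; exact: measurableI.
rewrite -nuE (@measureD _ _ _ nu)//.
have -> : (branch (lift S) w `&` E) `&` (lift S w D `&` E) = E `&` lift S w D.
  by apply/seteqP; split=> x; rewrite /setI/=; have := GD x; tauto.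
rewrite (setIidr CS); congr (_ - _).
  exact: etrans (HD _ FE) (esym (nuE _)).
exact: etrans (HG _ FE) (esym (nuE _)).
Qed.

(** Up to a null set, the preimage of an open [V] is the union of the lifted cells whose original
    cells have closure inside [V], and such unions have the prescribed measure. Open sets are closed
    under intersection and generate the Borel sets, which gives every [B]. *)
Theorem distribution_equivalent_selection : exists f : T -> A,
  measurable_fun setT (f : T -> borel A) /\
  forall E, F E -> forall B : set (borel A), measurable B ->
    lam (E `&` f @^-1` B) = \int[lam]_(t in E) g t B.
Proof.
have [U [oU baseU]] := regular_countable_base cA.
have mo V : open V -> measurable (V : set (borel A)) by exact: sub_sigma_algebra.
(* Cells of depth [k] are split by the base set [U k], so each branch decides on which side of every
   base set it lies. *)
pose S (w : seq bool) (C : set A) : set A := C `&` U (size w).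
have subS w C : S w C `<=` C by move=> x [].
have mS w : measurable (branch S w : set (borel A)).
  elim: w => [|[] w IH] /=; first exact: (@measurableT _ (borel A)).
    by apply: (@measurableI _ (borel A)) => //; exact: mo.
  apply: (@measurableD _ (borel A)) => //.
  by apply: (@measurableI _ (borel A)) => //; exact: mo.
pose L := lift S.
have subL w D : L w D `<=` D by move=> x [].
have mL w : measurable (branch L w) by exact: (lift_branch subS mS w).1.
have LE E W : F E -> lam ((\bigcup_(w in W) branch L w) `&` E) =
    \int[lam]_(t in E) g t (\bigcup_(w in W) branch S w).
  move=> FE; have mE := FT FE.
  have [nu nuE] := @ex_average_measure _ _ T (borel A) R lam E g mE mgT.
  rewrite -nuE; apply: (@branch_measure_eq _ _ T (borel A) R L S (mrestr lam mE)) => //.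
  by move=> w; rewrite nuE; exact: (lift_branch subS mS w).2.
(* Types whose branch reaches an empty cell of [A]; their measure is the integral of [g t set0]. *)
pose N := \bigcup_(w in [set w | branch S w = set0]) branch L w.
have mN : measurable N by exact: measurable_bigcup_branch.
have FsetT : F setT.
  rewrite -(measurable_with_salg HF.1); exact: (@measurableT _ (with_salg F)).
have N0 : lam N = 0.
  rewrite -[N]setIT LE// (_ : \bigcup_(w in _) _ = set0).
    by under eq_integral do rewrite measure0; rewrite integral0.
  by rewrite -subset0 => x [w /= ->].
pose K t := \bigcap_k closure (branch S (address L t k)).
have branch_nd t j k : (j <= k)%N ->
    branch S (address L t k) `<=` branch S (address L t j).
  elim: k => [|k IH]; first by rewrite leqn0 => /eqP ->.
  rewrite leq_eqVlt => /predU1P[-> //|/IH]; apply: subset_trans.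
  exact: (@branch_sub _ S subS).
have K0 t : ~ N t -> K t !=set0.
  move=> nN.
  have ne k : branch S (address L t k) !=set0.
    apply/set0P/eqP => b0; apply: nN.
    by exists (address L t k) => //; exact: branch_address.
  (* The nested nonempty cells on the branch generate a proper filter, and a cluster point of it
     lies in all their closures. *)
  pose H := filter_from [set: nat] (fun k => branch S (address L t k)).
  have FH : ProperFilter H.
    apply: filter_from_proper; last by move=> k _; exact: ne.
    apply: filter_from_filter; first by exists 0%N.
    move=> i j _ _; exists (maxn i j) => // x xb; split.
      by apply: branch_nd xb; exact: leq_maxl.
    by apply: branch_nd xb; exact: leq_maxr.
  have [|x [_ clx]] := cA FH; first by exists 0%N.
  exists x => k _ V Vx; apply: clx Vx => //.
  by exists k.
(* For [t] in [N] the set [K t] is empty, so [f] is constantly [point] there, which keeps it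
   measurable. *)
pose f t := xget point (K t).
have fK t : ~ N t -> K t (f t) by move=> /K0 [x]; exact: xgetI.
have fN t : N t -> f t = point.
  move=> [w /= w0 wt]; apply: xgetPN => x /(_ (size w) Logic.I).
  by rewrite -(address_branch subL wt) w0 closure0.
pose W V := [set w | closure (branch S w) `<=` V].
have preW V t : open V -> ~ N t ->
    V (f t) <-> (\bigcup_(w in W V) branch L w) t.
  move=> oV nN; split=> [Vf|[w Ww wt]]; last first.
    by apply: Ww; have := fK _ nN (size w) Logic.I; rewrite -(address_branch subL wt).
  (* At depth [j + 1] the split by [U j] has been made. The cell there has [f t] in its closure, so
     it meets the open set [U j]; hence it lies inside [U j] and its closure inside [V]. *)
  have [j [Ujf UV]] := baseU _ _ oV Vf.
  exists (address L t j.+1); last exact: branch_address.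
  rewrite /W /=; have := fK _ nN j.+1 Logic.I; rewrite /=.
  case: asboolP => _ /= clf.
    by apply: subset_trans UV; apply: closure_subset => x []; rewrite size_address.
  have [y [[Cy nUy] Uy]] := clf _ (open_nbhs_nbhs (conj (oU j) Ujf)).
  by exfalso; apply: nUy; split=> //; rewrite size_address.
have preE V : open V -> f @^-1` V =
    (\bigcup_(w in W V) branch L w `\` N) `|` (N `&` [set _ | V point]).
  move=> oV; apply/seteqP; split=> t.
    move=> Vf; have [Nt|nN] := pselect (N t).
      by right; split=> //=; rewrite -(fN _ Nt).
    by left; split=> //; apply/preW.
  by move=> [[Wt nN]|[Nt Vp]]; [apply/preW|rewrite /preimage/= fN].
have mf : measurable_fun setT (f : T -> borel A).
  apply: (@measurability _ _ T (borel A) setT f (@open A)) => //.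
  move=> _ [V oV <-]; rewrite setTI preE//; apply: measurableU.
    by apply: measurableD => //; exact: measurable_bigcup_branch.
  by apply: measurableI => //; have [Vp|nVp] := pselect (V point);
    [rewrite (_ : [set _ | _] = setT)|rewrite (_ : [set _ | _] = set0)];
    rewrite ?predeqE//; exact: measurableT.
exists f; split=> // E FE B mB; have mE := FT FE.
have [nu nuE] := @ex_average_measure _ _ T (borel A) R lam E g mE mgT.
have [m mE'] := ex_pushforward_measure (mrestr lam mE) mf.
have nullD X Y : measurable X -> measurable Y -> X `\` N = Y `\` N -> lam X = lam Y.
  have cutN Z : measurable Z -> lam Z = lam (Z `\` N).
    move=> mZ; rewrite (measureDI lam mZ mN) -[RHS]adde0; congr (_ + _).
    apply/eqP; rewrite eq_le measure_ge0 andbT -N0.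
    by apply: le_measure; rewrite ?inE//; exact: measurableI.
  by move=> mX mY XY; rewrite cutN// XY -cutN.
have mfpre C : measurable (C : set (borel A)) -> measurable (f @^-1` C).
  by move=> mC; rewrite -[X in measurable X]setTI; exact: mf.
rewrite -nuE setIC -[LHS]mE'.
apply: (@measure_unique _ R (borel A) (@open A) (fun=> setT)) => //.
- by move=> ? ?; exact: openI.
- by move=> _; exact: openT.
- by rewrite bigcup_const; [|exists 0%N].
- move=> V oV; rewrite mE' /= /mrestr nuE.
  transitivity (lam ((\bigcup_(w in W V) branch L w) `&` E)).
    apply: nullD.
    + by apply: measurableI => //; apply: mfpre; exact: mo.
    + by apply: measurableI => //; exact: measurable_bigcup_branch.
    + apply/seteqP; split=> t [[]].
        by move=> Vf Et nN; split=> //; split=> //; apply/preW.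
      by move=> Wt Et nN; split=> //; split=> //; apply/preW.
  rewrite LE//; apply: eq_integral => t _; congr (g t _).
  (* [V] is the union of the cells with closure in [V]: a point of [V] has some [U j] around it with
     closure in [V], and its cell of depth [j + 1] lies in [U j]. *)
  apply/seteqP; split=> x.
    by move=> [w Ww wx]; apply: Ww; exact: subset_closure.
  move=> Vx; have [j [Ujx UV]] := baseU _ _ oV Vx.
  exists (address S x j.+1); last exact: branch_address.
  rewrite /W /=; case: asboolP => [_|] /=.
    by apply: subset_trans UV; apply: closure_subset => y []; rewrite size_address.
  by case; split; [exact: branch_address|rewrite size_address].
- move=> _; rewrite mE' /= /mrestr preimage_setT setTI.
  by rewrite (le_lt_trans (probability_le1 _ _)) ?ltry.
Qed.

End selection.

(** * Product probabilities on finite products *)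

Section probability_existence.
Context d (T : measurableType d) (R : realType).
Local Open Scope ereal_scope.

Lemma ex_probability (mu : set T -> \bar R) :
  mu set0 = 0 -> (forall A, 0 <= mu A) -> semi_sigma_additive mu ->
  mu setT = 1 -> exists P : probability T R, forall A, P A = mu A.
Proof.
move=> h0 h1 h2 h3; pose im := isMeasure.Build _ _ _ mu h0 h1 h2.
pose m : {measure set T -> \bar R} := HB.pack mu im.
pose ifm := Measure_isProbability.Build _ _ _ m h3.
pose P : probability T R := HB.pack mu m ifm.
by exists P.
Qed.

End probability_existence.

Lemma ex_pushforward_probability d d' (T : measurableType d)
    (Y : measurableType d') (R : realType) (f : T -> Y) (P : probability T R) :
  measurable_fun setT f ->
  exists P' : probability Y R, forall B, P' B = P (f @^-1` B).
Proof.
move=> mf; have [m mE] := ex_pushforward_measure P mf.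
have [||||P' P'E] := @ex_probability _ Y R m.
- exact: measure0.
- by [].
- exact: measure_semi_sigma_additive.
- by rewrite mE preimage_setT; exact: probability_setT.
by exists P' => B; rewrite P'E mE.
Qed.

Section product.
Context (n : nat) (dT : 'I_n -> measure_display).
Variable T : forall i, measurableType (dT i).

Lemma measurable_rectangle (B : forall i, set (T i)) :
  (forall i, measurable (B i)) ->
  measurable ([set x | forall i, B i (x i)] : set (Tprod T)).
Proof. by move=> mB; apply: sub_sigma_algebra; exists B. Qed.

Lemma setI_closed_rectangles :
  setI_closed (rectangles (fun i => @measurable _ (T i))).
Proof.
move=> _ _ [B [mB ->]] [C [mC ->]]; exists (fun i => B i `&` C i); split.
  by move=> i; exact: measurableI.
by apply/seteqP; split=> x; [move=> [? ?] i; split|move=> BC; split=> i; case: (BC i)].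
Qed.

Lemma measurable_coordinate i : measurable_fun setT (fun x : Tprod T => x i).
Proof.
move=> _ B mB; rewrite setTI.
have mB' j : measurable (dfwith (fun j => setT : set (T j)) i B j).
  by case: dfwithP.
rewrite (_ : _ @^-1` B = [set x | forall j, dfwith (fun j => setT) i B j (x j)]).
  exact: measurable_rectangle mB'.
apply/seteqP; split=> x /=; last by move/(_ i); rewrite dfwithin.
by move=> Bx j; case: dfwithP.
Qed.

Lemma measurable_fun_Tprod d (Y : measurableType d) (f : Y -> Tprod T) :
  (forall i, measurable_fun setT (fun y => f y i)) -> measurable_fun setT f.
Proof.
move=> mf; apply: (@measurability _ _ Y (Tprod T) setT f
  (rectangles (fun i => @measurable _ (T i)))) => //.
move=> _ [_ [B [mB ->]] <-]; rewrite setTI.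
rewrite (_ : _ @^-1` _ = \bigcap_(i in [set: 'I_n]) ((fun y => f y i) @^-1` B i)).
  apply: fin_bigcap_measurable => // i _.
  by rewrite -[X in measurable X]setTI; exact: mf.
by apply/seteqP; split=> y H i; [move=> _; exact: H|exact: (H i Logic.I)].
Qed.

Local Open Scope ereal_scope.
Context {R : realType}.

Lemma measurable_prode (I : Type) d (Y : measurableType d) (s : seq I)
    (h : I -> Y -> \bar R) :
  (forall i, measurable_fun setT (h i)) ->
  measurable_fun setT (fun y => \prod_(i <- s) h i y).
Proof.
move=> mh; elim: s => [|i s IH].
  by under eq_fun do rewrite big_nil; exact: measurable_cst.
by under eq_fun do rewrite big_cons; exact: emeasurable_funM.
Qed.

(** Coordinates are added one at a time: a probability good for [s] is multiplied by [mu i] and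
    pushed forward by overwriting coordinate [i]. Working with nonnegative functions rather than
    boxes lets Tonelli's theorem carry out the induction step. *)
Lemma ex_product_probability (mu : forall i, probability (T i) R) :
  exists P : probability (Tprod T) R, forall phi : forall i, T i -> \bar R,
    (forall i, measurable_fun setT (phi i)) -> (forall i x, 0 <= phi i x) ->
    \int[P]_x \prod_(i < n) phi i (x i) = \prod_(i < n) \int[mu i]_x phi i x.
Proof.
suff : forall s : seq 'I_n, uniq s -> exists P : probability (Tprod T) R,
    forall phi : forall i, T i -> \bar R,
    (forall i, measurable_fun setT (phi i)) -> (forall i x, 0 <= phi i x) ->
    \int[P]_x \prod_(i <- s) phi i (x i) = \prod_(i <- s) \int[mu i]_x phi i x.
  by apply; exact: index_enum_uniq.
elim=> [_|i s IH /= /andP[iNs us]].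
  exists (dirac (point : Tprod T)) => phi mphi phi0.
  under eq_integral do rewrite big_nil.
  by rewrite big_nil integral_cst// mul1e; exact: probability_setT.
have [P PE] := IH us.
pose f (p : Tprod T * T i) : Tprod T := dfwith p.1 i p.2.
have mf : measurable_fun setT f.
  apply: measurable_fun_Tprod => j; rewrite /f.
  have [<-|ij] := eqVneq i j.
    have -> : (fun p : Tprod T * T i => dfwith p.1 i p.2 i) = snd.
      by apply/funext => p; exact: dfwithin.
    exact: measurable_snd.
  have -> : (fun p : Tprod T * T i => dfwith p.1 i p.2 j) = (fun p => p.1 j).
    by apply/funext => p; exact: dfwithout.
  exact: (measurableT_comp (@measurable_coordinate j)
    (@measurable_fst _ _ (Tprod T) (T i))).
have [P' P'E] := ex_pushforward_probability (P \x mu i) mf.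
exists P' => phi mphi phi0.
have mcoord j : measurable_fun setT (fun x : Tprod T => phi j (x j)).
  exact: (measurableT_comp (mphi j) (@measurable_coordinate j)).
have mprod r : measurable_fun setT (fun x : Tprod T => \prod_(j <- r) phi j (x j)).
  exact: (@measurable_prode _ _ _ r (fun j (x : Tprod T) => phi j (x j))).
have prod0 r (x : Tprod T) : 0 <= \prod_(j <- r) phi j (x j) by exact: prode_ge0.
transitivity (\int[pushforward (P \x mu i) f]_x \prod_(j <- i :: s) phi j (x j)).
  by apply: eq_measure_integral => A mA _; exact: P'E.
rewrite ge0_integral_pushforward//.
rewrite preimage_setT /=.
have fE (p : Tprod T * T i) : \prod_(j <- i :: s) phi j (f p j) =
    phi i p.2 * \prod_(j <- s) phi j (p.1 j).
  rewrite big_cons /f; congr (_ * _); first by congr phi; exact: dfwithin.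
  apply: eq_big_seq => j js; congr phi; apply: dfwithout.
  by apply: contraNneq iNs => ->.
under eq_integral do rewrite /comp fE.
rewrite fubini_tonelli1/=; last 2 first.
- apply: emeasurable_funM.
    exact: (measurableT_comp (mphi i) (@measurable_snd _ _ (Tprod T) (T i))).
  exact: (measurableT_comp (mprod s) (@measurable_fst _ _ (Tprod T) (T i))).
- by move=> p; apply: mule_ge0.
rewrite /fubini_F /=.
under eq_integral do rewrite ge0_integralZr//.
by rewrite ge0_integralZl//= ?PE ?big_cons//; exact: integral_ge0.
Qed.

Lemma prod_indic (B : forall i, set (T i)) (x : forall i, T i) :
  \prod_(i < n) (\1_(B i) (x i))%:E = (\1_[set x | forall i, B i (x i)] x)%:E :> \bar R.
Proof.
have [H|H] := pselect (forall i, B i (x i)).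
  rewrite [in RHS]indicE mem_set// big1// => i _.
  by rewrite indicE mem_set//; exact: H.
rewrite [in RHS]indicE memNset//; have /existsNP[i nB] := H.
by rewrite (bigD1 i)//= indicE memNset// mul0e.
Qed.

Lemma is_product_measure_unique (P Q : {measure set (Tprod T) -> \bar R})
    (mu : forall i, probability (T i) R) :
  is_product_measure (fun i => @measurable _ (T i)) P (fun i => mu i) ->
  is_product_measure (fun i => @measurable _ (T i)) Q (fun i => mu i) ->
  forall A, measurable A -> P A = Q A.
Proof.
move=> HP HQ; apply: (@measure_unique _ R (Tprod T)
  (rectangles (fun i => @measurable _ (T i))) (fun=> setT)) => //.
- exact: setI_closed_rectangles.
- by move=> _; exists (fun=> setT); split=> //; apply/seteqP; split.
- by rewrite bigcup_const//; exists 0%N.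
- by move=> _ [B [mB ->]]; rewrite HP// HQ.
- move=> _; have -> : [set: Tprod T] = [set x | forall i, (fun i => [set: T i]) i (x i)].
    by apply/seteqP; split.
  have -> := HP (fun i => [set: T i]) (fun i => measurableT).
  by rewrite big1 ?ltry// => i _; exact: probability_setT.
Qed.

Lemma is_product_measure_integral (P : probability (Tprod T) R)
    (mu : forall i, probability (T i) R) :
  (forall phi : forall i, T i -> \bar R,
    (forall i, measurable_fun setT (phi i)) -> (forall i x, 0 <= phi i x) ->
    \int[P]_x \prod_(i < n) phi i (x i) = \prod_(i < n) \int[mu i]_x phi i x) ->
  is_product_measure (fun i => @measurable _ (T i)) P (fun i => mu i).
Proof.
move=> PE B mB.
transitivity (\int[P]_x \prod_(i < n) (\1_(B i) (x i))%:E).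
  under eq_integral do rewrite prod_indic.
  by rewrite integral_indic ?setIT//; exact: measurable_rectangle.
rewrite (PE (fun i x => (\1_(B i) x)%:E))//.
  by apply: eq_bigr => i _; rewrite integral_indic ?setIT.
by move=> i; apply/measurable_EFinP; exact: measurable_indic.
Qed.

Lemma integral_product (P : probability (Tprod T) R)
    (mu : forall i, probability (T i) R) (phi : forall i, T i -> \bar R) :
  is_product_measure (fun i => @measurable _ (T i)) P (fun i => mu i) ->
  (forall i, measurable_fun setT (phi i)) -> (forall i x, 0 <= phi i x) ->
  \int[P]_x \prod_(i < n) phi i (x i) = \prod_(i < n) \int[mu i]_x phi i x.
Proof.
move=> HP mphi phi0; have [Q QE] := ex_product_probability mu.
rewrite -QE//; apply: eq_measure_integral => A mA _.
exact: (is_product_measure_unique HP (is_product_measure_integral QE) mA).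
Qed.

End product.

(** * Borel sets of the space of action profiles *)

Section product_borel.
Context (R : realType) (n : nat) (A : 'I_n -> pseudoPMetricType R).

(** The filter of open boxes around [x] converges to [x] in every coordinate, hence in the product
    topology. *)
Lemma open_Aprod_box (O : set (Aprod A)) x : open O -> O x ->
  exists B : forall i, set (A i), (forall i, open (B i) /\ B i (x i)) /\
    [set y | forall i, B i (y i)] `<=` O.
Proof.
move=> oO Ox.
pose F : set_system (Aprod A) := filter_from
  [set B : forall i, set (A i) | forall i, open (B i) /\ B i (x i)]
  (fun B => [set y | forall i, B i (y i)]).
have FF : Filter F.
  apply: filter_from_filter.
    by exists (fun i => setT) => i; split=> //; exact: openT.
  move=> B C HB HC; exists (fun i => B i `&` C i).
    move=> i; have [oB Bx] := HB i; have [oC Cx] := HC i.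
    by split; [exact: openI|].
  by move=> y BC; split=> i; case: (BC i).
have : F O.
  apply: (_ : F --> (x : Aprod A)); last exact: open_nbhs_nbhs.
  apply/cvg_sup => i V; rewrite nbhsE => -[W [[W' oW' <-] Wx] WV].
  exists (dfwith (fun j => setT : set (A j)) i W').
    by move=> j; case: dfwithP => // k; split=> //; exact: openT.
  by move=> y /(_ i); rewrite dfwithin => W'y; apply: WV.
by move=> [B HB BO]; exists B.
Qed.

Hypothesis cA : forall i, compact [set: A i].

(** An open set is a union of boxes with sides in the countable bases. These are countably many,
    being indexed by finite functions into [nat]. *)
Lemma open_Aprod_measurable (O : set (Aprod A)) : open O ->
  measurable (O : set (Tprod (fun i => borel (A i)))).
Proof.
move=> oO; pose U i := sval (cid (regular_countable_base (@cA i))).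
have oU i := (svalP (cid (regular_countable_base (@cA i)))).1.
have UP i := (svalP (cid (regular_countable_base (@cA i)))).2.
pose box (p : {ffun 'I_n -> nat}) : set (Aprod A) := [set y | forall i, U i (p i) (y i)].
rewrite (_ : O = \bigcup_(p in [set p | box p `<=` O]) box p); last first.
  apply/seteqP; split=> x; last by move=> [p pO px]; exact: pO.
  move=> Ox; have [B [HB BO]] := open_Aprod_box oO Ox.
  have ex i : exists k, U i k (x i) /\ U i k `<=` B i.
    have [oB Bx] := HB i; have [k [Ux UB]] := UP i _ _ oB Bx.
    by exists k; split=> //; exact: subset_trans (@subset_closure _ _) UB.
  pose p : {ffun 'I_n -> nat} := [ffun i => sval (cid (ex i))].
  exists p; last by move=> i; rewrite ffunE; case: (svalP (cid (ex i))).
  move=> y py; apply: BO => i; move: (py i); rewrite ffunE.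
  by case: (svalP (cid (ex i))) => _; apply.
rewrite bigcup_mkcond; apply: (@countable_bigcupT_measurable _
  (Tprod (fun i => borel (A i)))) => // p.
case: ifP => // _.
apply: (@measurable_rectangle n _ (fun i => borel (A i)) (fun i => U i (p i))) => i.
by apply: sub_sigma_algebra; exact: oU.
Qed.

Lemma measurable_borel_Aprod :
  @measurable _ (borel (Aprod A)) =
  <<s rectangles (fun i => @measurable _ (borel (A i))) >>.
Proof.
apply/seteqP; split.
  apply: smallest_sub; first exact: smallest_sigma_algebra.
  exact: open_Aprod_measurable.
apply: smallest_sub; first exact: smallest_sigma_algebra.
move=> _ [B [mB ->]].
rewrite (_ : [set x | _] =
  \bigcap_(i in [set: 'I_n]) ((fun y : borel (Aprod A) => y i) @^-1` B i)).
  apply: (@fin_bigcap_measurable _ (borel (Aprod A))) => // i _.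
  rewrite -[X in measurable X]setTI.
  apply: (@measurability _ _ (borel (Aprod A)) (borel (A i)) setT
    (fun y => y i) (@open (A i))) => //.
  move=> _ [V oV <-]; rewrite setTI; apply: sub_sigma_algebra.
  by apply: (open_comp _ oV) => y _; exact: proj_continuous.
by apply/seteqP; split=> y H i; [move=> _; exact: H|exact: (H i Logic.I)].
Qed.

Local Open Scope ereal_scope.

(** [prodP] is chosen by [get], so the existence of a product probability is what gives it the
    product property. One exists on the sigma-algebra of boxes, which is the Borel one. *)
Lemma prodP_product (mus : forall i, probability (borel (A i)) R) :
  is_product_measure (fun i => @measurable _ (borel (A i))) (prodP mus)
    (fun i => mus i).
Proof.
have [Q /is_product_measure_integral HQ] :=
  @ex_product_probability n _ (fun i => borel (A i)) R mus.
have mid : measurable_fun setT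
    (fun x : Tprod (fun i => borel (A i)) => (x : borel (Aprod A))).
  by move=> _ B; rewrite setTI measurable_borel_Aprod.
have [P PE] := ex_pushforward_probability Q mid.
apply: (@getPex _ [set P : probability (borel (Aprod A)) R |
  is_product_measure (fun i => @measurable _ (borel (A i))) P (fun i => mus i)]).
by exists P => B mB; rewrite PE; exact: HQ.
Qed.

Lemma borel_Aprod_unique (P Q : {measure set (borel (Aprod A)) -> \bar R}) :
  P setT < +oo ->
  (forall B : forall i, set (A i), (forall i, measurable (B i : set (borel (A i)))) ->
    P [set x | forall i, B i (x i)] = Q [set x | forall i, B i (x i)]) ->
  forall B, measurable B -> P B = Q B.
Proof.
move=> Poo PQ; apply: (@measure_unique _ R (borel (Aprod A))
  (rectangles (fun i => @measurable _ (borel (A i)))) (fun=> setT)) => //.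
- exact: measurable_borel_Aprod.
- exact: (@setI_closed_rectangles _ _ (fun i => borel (A i))).
- by move=> _; exists (fun i => setT); split=> //; apply/seteqP; split.
- by rewrite bigcup_const//; exists 0%N.
- by move=> _ [B [mB ->]]; exact: PQ.
Qed.

(** Dynkin induction from boxes, where the value is a finite product of measurable functions. *)
Lemma measurable_fun_prodP d (Y : measurableType d)
    (k : forall i, Y -> probability (borel (A i)) R) :
  (forall i (B : set (borel (A i))), measurable B ->
    measurable_fun setT (fun y => k i y B)) ->
  forall B : set (borel (Aprod A)), measurable B ->
    measurable_fun setT (fun y => prodP (fun i => k i y) B).
Proof.
move=> mk B; rewrite measurable_borel_Aprod; apply: (@dynkin_induction _ (borel (Aprod A))
  _ (fun B => measurable_fun setT (fun y => prodP (fun i => k i y) B))).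
- exact: measurable_borel_Aprod.
- exact: (@setI_closed_rectangles _ _ (fun i => borel (A i))).
- by under eq_fun do rewrite probability_setT; exact: measurable_cst.
- move=> _ [C [mC ->]].
  under eq_fun do rewrite prodP_product//.
  by apply: measurable_prode => i; exact: mk.
- move=> S mS IH.
  under eq_fun do rewrite probability_setC//.
  exact: emeasurable_funB.
move=> S mS tS IH.
under eq_fun do rewrite measure_bigcup//.
by apply: ge0_emeasurable_sum => m => [y _ _|_]; [exact: measure_ge0|exact: IH].
Qed.

End product_borel.

(** * Kernels and joint laws *)

Lemma ex_probability_kernel dX dY (X : measurableType dX) (Y : measurableType dY)
    (R : realType) (K : X -> probability Y R) :
  (forall B, measurable B -> measurable_fun setT (fun x => K x B)) ->
  exists k : R.-pker X ~> Y, forall x B, k x B = K x B.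
Proof.
move=> mK; pose K' : X -> {measure set Y -> \bar R} := K.
pose ik := isKernel.Build _ _ X Y R K' mK.
pose k0 : R.-ker X ~> Y := HB.pack K' ik.
pose ip := Kernel_isProbability.Build _ _ X Y R k0
  (fun x => probability_setT (K x)).
pose k : R.-pker X ~> Y := HB.pack K' k0 ip.
by exists k.
Qed.

Section joint.
Context dX dY dW (X : measurableType dX) (Y : measurableType dY)
  (W : measurableType dW) (R : realType).
Local Open Scope ereal_scope.

(** The law of [(y, h x)] when [x] follows [mu] and [y] follows [K x], given by its values and by
    its integration formula. *)
Definition is_joint_measure (mu : probability X R) (K : X -> probability Y R)
    (h : X -> W) (M : {measure set (Y * W) -> \bar R}) :=
  (forall S, measurable S -> M S = \int[mu]_x K x [set y | S (y, h x)]) /\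
  forall phi, (forall z, 0 <= phi z) -> measurable_fun setT phi ->
    measurable_fun setT (fun x => \int[K x]_y phi (y, h x)) /\
    \int[M]_z phi z = \int[mu]_x \int[K x]_y phi (y, h x).

Lemma ex_joint_measure (mu : probability X R) (K : X -> probability Y R)
    (h : X -> W) :
  (forall B, measurable B -> measurable_fun setT (fun x => K x B)) ->
  measurable_fun setT h ->
  exists M, is_joint_measure mu K h M.
Proof.
move=> mK mh; have [k kE] := ex_probability_kernel mK.
have mpair x : measurable_fun setT (fun y : Y => (y, h x)).
  by apply: measurable_fun_pair => //; exact: measurable_cst.
have msec : measurable_fun setT (fun p : X * Y => (p.2, h p.1)).
  apply: measurable_fun_pair; first exact: measurable_snd.
  exact: (measurableT_comp mh (@measurable_fst _ _ X Y)).
pose J x := sval (cid (ex_pushforward_probability (K x) (mpair x))).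
have JE x S : J x S = K x [set y | S (y, h x)].
  exact: (svalP (cid (ex_pushforward_probability (K x) (mpair x)))).
have mJ S : measurable S -> measurable_fun setT (fun x => J x S).
  move=> mS; have mS' : measurable [set p : X * Y | S (p.2, h p.1)].
    by rewrite -[X in measurable X]setTI; exact: msec.
  have := @measurable_fun_xsection_finite_kernel _ _ X Y R k _ (mem_set mS').
  apply: eq_measurable_fun => x _; rewrite JE kE; congr (K x _).
  by apply/seteqP; split=> y; rewrite /xsection/= inE.
(* [mu] becomes a constant kernel, so that the joint law is a composition of kernels evaluated at an
   arbitrary point. *)
have [l lE] := @ex_probability_kernel _ _ X X R (fun=> mu)
  (fun B mB => measurable_cst _).
have [j jE] := @ex_probability_kernel _ _ (X * X)%type (Y * W)%type R
  (fun p => J p.2) (fun S mS => measurableT_comp (mJ S mS) measurable_snd).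
exists (mkcomp l j point); split.
  move=> S mS; rewrite /mkcomp /= /kcomp.
  transitivity (\int[l point]_x K x [set y | S (y, h x)]).
    by apply: eq_integral => x _; rewrite jE JE.
  by apply: eq_measure_integral => A mA _; exact: lE.
move=> phi phi0 mphi; split.
  pose psi (p : X * Y) := phi (p.2, h p.1).
  have mpsi : measurable_fun setT psi by exact: (measurableT_comp mphi msec).
  have := measurable_fun_integral_finite_kernel psi k (fun z => phi0 _) mpsi.
  apply: eq_measurable_fun => x _.
  by apply: eq_measure_integral => A mA _; exact: kE.
rewrite [LHS](integral_kcomp l j point phi0 mphi).
transitivity (\int[l point]_x \int[K x]_y phi (y, h x)).
  apply: eq_integral => x _.
  transitivity (\int[pushforward (K x) (fun y => (y, h x))]_z phi z).
    by apply: eq_measure_integral => A mA _; rewrite jE JE.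
  by rewrite ge0_integral_pushforward// preimage_setT.
by apply: eq_measure_integral => A mA _; exact: lE.
Qed.

End joint.

(** * Payoffs as integrals against joint laws *)

Section joint_payoff.
Context (R : realType) (n : nat) (A : 'I_n -> pseudoPMetricType R).
Hypothesis cA : forall i, compact [set: A i].
Context (dT : 'I_n -> measure_display) (T : forall i, measurableType (dT i)).
Variables (lam_ : forall i, probability (T i) R) (lam : probability (Tprod T) R).
Hypothesis Hmarg : forall i (E : set (T i)), measurable E ->
  lam [set t : Tprod T | E (t i)] = lam_ i E.
Hypothesis Hprod :
  is_product_measure (fun i => @measurable _ (T i)) lam (fun i => lam_ i).
Variables (i : 'I_n) (F : set (set (T i))).
Hypothesis HF : is_sub_sigma_algebra F.
Local Open Scope ereal_scope.

(** Uniqueness is used twice: for fixed [D], boxes determine the slice over [D] as a measure on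
    action profiles; then rectangles determine the whole measure. *)
Lemma joint_measure_unique d (W : measurableType d)
    (M1 M2 : {measure set (borel (Aprod A) * W) -> \bar R}) :
  M1 setT < +oo ->
  (forall (B : forall i, set (A i)) (D : set W),
    (forall i, measurable (B i : set (borel (A i)))) -> measurable D ->
    M1 ([set x | forall i, B i (x i)] `*` D) =
    M2 ([set x | forall i, B i (x i)] `*` D)) ->
  forall S, measurable S -> M1 S = M2 S.
Proof.
move=> M1oo M12; apply: (@measure_unique _ R (borel (Aprod A) * W)%type
  [set C `*` D | C in measurable & D in measurable] (fun=> setT)) => //.
- exact: measurable_prod_measurableType.
- move=> _ _ [C mC [D mD <-]] [C' mC' [D' mD' <-]].
  exists (C `&` C'); first exact: measurableI.
  by exists (D `&` D'); [exact: measurableI|rewrite setXI].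
- by move=> _; exists setT => //; exists setT => //; rewrite setXTT.
- by rewrite bigcup_const//; exists 0%N.
move=> _ [C mC [D mD <-]].
have mTD : measurable ([set: borel (Aprod A)] `*` D) by exact: measurableX.
have slice (M : {measure set (borel (Aprod A) * W) -> \bar R}) :
    exists m : {measure set (borel (Aprod A)) -> \bar R}, forall C, m C = M (C `*` D).
  have [m mE] := ex_pushforward_measure (mrestr M mTD) (@measurable_fst _ _ _ _).
  exists m => C'; rewrite mE /= /mrestr; congr (M _).
  by apply/seteqP; split=> -[a w] /=; tauto.
have [m1 m1E] := slice M1; have [m2 m2E] := slice M2.
rewrite -m1E -m2E; apply: (@borel_Aprod_unique R n A cA) => //.
  rewrite m1E (le_lt_trans _ M1oo)//.
  by apply: le_measure; rewrite ?inE//; exact: measurableT.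
by move=> B mB; rewrite m1E m2E M12.
Qed.

Definition evaluable (k : forall j, T j -> probability (borel (A j)) R) :=
  forall j (B : set (borel (A j))), measurable B -> measurable_fun setT (fun t => k j t B).

(** The type of player [i] is observed through [F] only, so rectangles have their type side in [F],
    where distribution equivalence applies. *)
Definition is_joint (k : forall j, T j -> probability (borel (A j)) R)
    (M : {measure set (borel (Aprod A) * with_salg F) -> \bar R}) :=
  is_joint_measure lam (fun t => prodP (fun j => k j (t j)))
    (fun t => t i : with_salg F) M.

Lemma ex_joint k : evaluable k -> exists M, is_joint k M.
Proof.
move=> mk; apply: (@ex_joint_measure _ _ _ (Tprod T) (borel (Aprod A))
  (with_salg F) R lam (fun t => prodP (fun j => k j (t j))) (fun t => t i)).
  apply: (measurable_fun_prodP cA (k := fun j (t : Tprod T) => k j (t j))) => j B mB.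
  exact: (measurableT_comp (mk j B mB) (@measurable_coordinate _ _ T j)).
have mc := @measurable_coordinate _ _ T i.
move=> _ D mD; rewrite setTI -[X in measurable X]setTI; apply: mc => //.
by move: mD; rewrite measurable_with_salg; [exact: HF.2|exact: HF.1].
Qed.

(** Actions are independent given the types, and types are independent by [Hprod]. *)
Lemma joint_box k M (B : forall j, set (A j)) (D : set (T i)) :
  evaluable k -> is_joint k M ->
  (forall j, measurable (B j : set (borel (A j)))) -> F D ->
  M ([set x | forall j, B j (x j)] `*` D) =
  \prod_(j < n) \int[lam_ j]_(t in dfwith (fun j => [set: T j]) i D j) k j t (B j).
Proof.
(* With the whole space in the other coordinates, the restriction on one player's type becomes a
   product over all players. *)
move=> mk [ME _] mB FD; set D' := dfwith _ i D.
have mD' j : measurable (D' j) by rewrite /D'; case: dfwithP => //; exact: HF.2.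
have mbox : measurable ([set x | forall j, B j (x j)] : set (borel (Aprod A))).
  by rewrite (measurable_borel_Aprod cA); apply: sub_sigma_algebra; exists B.
rewrite ME; last first.
  by apply: measurableX => //; rewrite measurable_with_salg//; exact: HF.1.
pose psi j t := k j t (B j) * (\1_(D' j) t)%:E.
have mpsi j : measurable_fun setT (psi j).
  apply: emeasurable_funM; first exact: mk.
  by apply/measurable_EFinP; exact: measurable_indic.
transitivity (\int[lam]_t \prod_(j < n) psi j (t j)).
  apply: eq_integral => t _; rewrite big_split/= (@prod_indic _ _ T).
  rewrite -(prodP_product cA (fun j => k j (t j)) mB) indicE.
  have D'E : (forall j, D' j (t j)) <-> D (t i).
    split=> [/(_ i)|Dt j]; first by rewrite /D' dfwithin.
    by rewrite /D'; case: dfwithP.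
  have [Dt|nDt] := pselect (D (t i)).
    rewrite mem_set ?mule1; last exact/D'E.
    by congr (prodP _ _); apply/seteqP; split=> a //= -[].
  rewrite memNset ?mule0; last by move/D'E.
  rewrite (_ : [set a | _] = set0) ?measure0//.
  by rewrite -subset0 => a [].
rewrite (integral_product Hprod)//; last first.
  by move=> j t; rewrite mule_ge0// lee_fin.
apply: eq_bigr => j _; rewrite [RHS]integral_mkcond.
apply: eq_integral => t _; rewrite /psi patchE indicE.
by case: ifP => _; rewrite ?mule1 ?mule0.
Qed.

Variables (u : Aprod A -> T i -> R) (h : T i -> R).
Hypothesis mu : measurable_fun setT
  (fun p : (borel (Aprod A) * with_salg F)%type => u p.1 p.2).
Hypothesis inth : (lam_ i).-integrable setT (fun t => (h t)%:E).
Hypothesis uh : forall a t, (`|u a t| <= h t)%R.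

Let v (z : borel (Aprod A) * with_salg F) := (u z.1 z.2)%:E.

(** The integration formula of the joint law concerns nonnegative integrands, so [v] is split into
    its positive and negative parts; the bound [h] makes both integrable, which permits the
    subtraction. *)
Lemma payoff_joint k M (E : set (T i)) : evaluable k -> is_joint k M -> F E ->
  \int[lam]_(t in [set t : Tprod T | E (t i)])
    \int[prodP (fun j => k j (t j))]_a (u a (t i))%:E =
  \int[M]_(z in [set z | E z.2]) v z.
Proof.
move=> mk [_ HM] FE.
have mE : measurable (E : set (T i)) by exact: HF.2.
have mET : measurable ([set t | E (t i)] : set (Tprod T)).
  by rewrite -[X in measurable X]setTI; exact: (@measurable_coordinate _ _ T i).
have mv : measurable_fun setT v by exact/measurable_EFinP.
have mEZ : measurable ([set z | E z.2] : set (borel (Aprod A) * with_salg F)).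
  have mEF : measurable (E : set (with_salg F)).
    by rewrite measurable_with_salg//; exact: HF.1.
  rewrite -[X in measurable X]setTI.
  exact: (@measurable_snd _ _ (borel (Aprod A)) (with_salg F) measurableT).
have cut (w : borel (Aprod A) * with_salg F -> \bar R) :
    (forall z, 0 <= w z) -> measurable_fun setT w ->
    (forall z, w z <= (h z.2)%:E) ->
    let I t := \int[prodP (fun j => k j (t j))]_a w (a, t i) in
    lam.-integrable [set t : Tprod T | E (t i)] I /\
    \int[lam]_(t in [set t : Tprod T | E (t i)]) I t =
    \int[M]_(z in [set z | E z.2]) w z.
  move=> w0 mw wh I; have [mI _] := HM w w0 mw.
  split.
    apply: (@integrableS _ _ _ lam setT) => //.
    apply: (@le_integrable _ _ _ lam setT measurableT _ (fun t => (h (t i))%:E)) => //.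
      move=> t _; rewrite gee0_abs; last exact: integral_ge0.
      have h0 : (0 <= h (t i))%R by rewrite (le_trans _ (uh point _)).
      rewrite gee0_abs ?lee_fin//.
      apply: (@le_trans _ _ (\int[prodP (fun j => k j (t j))]_a cst (h (t i))%:E a)).
        apply: ge0_le_integral => //.
          exact: (measurableT_comp mw (pair2_measurable _)).
      rewrite integral_cst// -[leRHS]mule1 lee_wpmul2l ?lee_fin//.
      exact: probability_le1.
    have [mh hoo] := integrableP _ _ _ inth.
    apply/integrableP; split.
      exact: (measurableT_comp mh (@measurable_coordinate _ _ T i)).
    rewrite (le_lt_trans _ hoo)//.
    (* The marginal of [lam] on coordinate [i] is [lam_ i], which transfers the integrability of
       [h]. *)
    rewrite -[leLHS](@ge0_integral_pushforward _ _ _ _ _ (fun t : Tprod T => t i)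
      (@measurable_coordinate _ _ T i) lam setT (fun t => `|(h t)%:E|))//.
      rewrite le_eqVlt; apply/orP; left; apply/eqP.
      apply: eq_measure_integral; first exact: measurable_coordinate.
      by move=> mc C mC _; exact: Hmarg.
    exact: measurableT_comp.
  rewrite [RHS]integral_mkcond; have [||_ ->] := HM (w \_ [set z | E z.2]).
  - by move=> z; exact: erestrict_ge0.
  - by apply/(measurable_restrictT _ mEZ); exact: measurable_funTS.
  rewrite [LHS]integral_mkcond; apply: eq_integral => t _.
  rewrite patchE; case: ifPn => [/set_mem Et|/negP nEt].
    by apply: eq_integral => a _; rewrite patchE mem_set.
  rewrite integral0_eq// => a _; rewrite patchE memNset// => Et.
  by apply: nEt; exact/mem_set.
have vh z : v^\+ z + v^\- z <= (h z.2)%:E.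
  rewrite -[leLHS](congr1 (fun w => w z) (fune_abse v)) /= lee_fin; exact: uh.
have [intP EP] := cut v^\+ (funepos_ge0 _) (measurable_funepos mv)
  (fun z => le_trans (leeDl _ (funeneg_ge0 _ z)) (vh z)).
have [intN EN] := cut v^\- (funeneg_ge0 _) (measurable_funeneg mv)
  (fun z => le_trans (leeDr _ (funepos_ge0 _ z)) (vh z)).
rewrite [RHS]integralE -EP -EN -integralB//.
apply: eq_integral => t _; rewrite [LHS]integralE.
by congr (_ - _); apply: eq_integral => a _; rewrite unlock.
Qed.

End joint_payoff.

(** * Belief consistency *)

Lemma belief_consistent_selection d (T : measurableType d) (R : realType)
    (lam : probability T R) (F : set (set T)) (A : pseudoPMetricType R)
    (f : T -> A) (g : T -> probability (borel A) R) :
  is_sub_sigma_algebra F -> compact [set: A] ->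
  measurable_fun setT (f : T -> borel A) ->
  (forall B : set (borel A), measurable B ->
    measurable_fun setT ((fun t => g t B) : with_salg F -> \bar R)) ->
  (forall E, F E -> forall B : set (borel A), measurable B ->
    lam (E `&` f @^-1` B) = \int[lam]_(t in E) g t B)%E ->
  {ae lam, forall t, msupp (g t) (f t)}.
Proof.
move=> HF cA mf mg fg; have [U [oU baseU]] := regular_countable_base cA.
have mU k : measurable (U k : set (borel A)) by apply: sub_sigma_algebra; exact: oU.
pose E k := [set t | g t (U k) = 0%E].
have FE k : F (E k).
  rewrite -(measurable_with_salg HF.1) -[X in measurable X]setTI.
  exact: (mg _ (mU k) measurableT _ (emeasurable_set1 0%E)).
(* An action outside the support has a base set [U k] around it that is null for [g t]. For each [k]
   such types have measure the integral of [g t (U k)] over [E k], which is zero. *)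
apply: (@negligibleS _ _ _ lam (\bigcup_k (E k `&` f @^-1` U k))).
  move=> t /= /existsNP[V /not_implyP[oV /not_implyP[Vft nV]]].
  have [k [Uft UV]] := baseU _ _ oV Vft.
  exists k => //; split=> //; apply/eqP; rewrite eq_le measure_ge0 andbT leNgt.
  apply/negP => gU; apply: nV; apply: lt_le_trans gU _.
  apply: le_measure; rewrite ?inE//; first exact: sub_sigma_algebra.
  exact: subset_trans (@subset_closure _ _) UV.
apply: negligible_bigcup => k; apply/negligibleP.
  apply: measurableI; first exact: HF.2.
  by rewrite -[X in measurable X]setTI; exact: mf.
apply: etrans (fg _ (FE k) _ (mU k)) _.
by rewrite (eq_integral (cst 0%E)) ?integral0// => t /set_mem.
Qed.

(** * Purification of all players' strategies together *)

Theorem theorem2 (R : realType) (n : nat)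
  (* action spaces: compact metric spaces *)
  (A : 'I_n -> pseudoPMetricType R)
  (HAmetric : forall i, hausdorff_space (A i))
  (HAcompact : forall i, compact [set: A i])
  (* information spaces (T_i, 𝒯_i, λ_i) *)
  (dT : 'I_n -> measure_display) (T : forall i, measurableType (dT i))
  (lam_ : forall i, probability (T i) R)
  (Hcomplete : forall i, complete_measure (lam_ i))
  (Hatomless : forall i, atomless (lam_ i))
  (* common prior λ on (T, ⊗ 𝒯_i) with marginals λ_i *)
  (lam : probability (Tprod T) R)
  (Hmarg : forall i (E : set (T i)), measurable E ->
     lam [set t : Tprod T | E (t i)] = lam_ i E)
  (* sub-sigma-algebras F_i ⊆ 𝒯_i *)
  (F : forall i, set (set (T i)))
  (HF : forall i, is_sub_sigma_algebra (F i))
  (* payoffs *)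
  (u : forall i, Aprod A -> T i -> R) :
  (* Assumption (I) *)
  is_product_measure (fun i => @measurable _ (T i)) lam (fun i => lam_ i) ->
  (* Assumption (P') *)
  (forall i, countably_generated (F i)) ->
  (forall i, measurable_fun setT
     (fun p : (borel (Aprod A) * with_salg (F i))%type => u i p.1 p.2)) ->
  (forall i (t : T i), continuous (fun a : Aprod A => u i a t)) ->
  (exists h : forall i, T i -> R, forall i,
     [/\ measurable_fun setT (h i : with_salg (F i) -> R),
         (lam_ i).-integrable setT (fun t => (h i t)%:E) &
         forall (a : Aprod A) (t : T i), `|u i a t| <= h i t]) ->
  (* Assumption (RD) *)
  (forall i, atomless (lam_ i) /\ nowhere_equivalent (lam_ i) (F i)) ->
  (* conclusion *)
  forall g : forall i, T i -> probability (borel (A i)) R,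
    (forall i, measurable_fun setT
       (g i : with_salg (F i) -> pprobability (borel (A i)) R)) ->
    exists f : forall i, T i -> A i,
      [/\ forall i, measurable_fun setT (f i : T i -> borel (A i)),
          univ_distribution_equivalent lam_ F (pure_as_mixed f) g,
          univ_payoff_equivalent lam u F (pure_as_mixed f) g &
          belief_consistent lam_ f g].
Proof.
move=> Hprod _ mu _ [h Hh] RD g mg.
have gB i (B : set (borel (A i))) : measurable B ->
    measurable_fun setT ((fun t => g i t B) : with_salg (F i) -> \bar R).
  exact: (measurable_kernel (kprobability (mg i))).
have gB' i (B : set (borel (A i))) : measurable B ->
    measurable_fun setT (fun t => g i t B).
  by move=> mB; apply: (measurable_fun_with_salg (HF i)); exact: gB.
have sel i := distribution_equivalent_selection (HF i) (RD i).2 (@HAcompact i) (@gB i).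
pose f i := sval (cid (sel i)).
have mf i : measurable_fun setT (f i : T i -> borel (A i)) := (svalP (cid (sel i))).1.
have fE i E (FE : F i E) (B : set (borel (A i))) (mB : measurable B) :
    lam_ i (E `&` f i @^-1` B) = (\int[lam_ i]_(t in E) g i t B)%E.
  exact: (svalP (cid (sel i))).2.
have mpre i (B : set (borel (A i))) : measurable B -> measurable (f i @^-1` B).
  by move=> mB; rewrite -[X in measurable X]setTI; exact: mf.
have fpure : univ_distribution_equivalent lam_ F (pure_as_mixed f) g.
  move=> i E FE B mB; rewrite -fE// setIC -integral_indic; last 2 first.
  - exact: (HF i).2.
  - exact: mpre.
  by apply: eq_integral => t _.
have mpure : evaluable (pure_as_mixed f).
  move=> i B mB.
  have : measurable_fun setT (fun t => (\1_(f i @^-1` B) t)%:E : \bar R).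
    by apply/measurable_EFinP; apply: measurable_indic; exact: mpre.
  by apply: eq_measurable_fun => t _.
exists f; split=> //.
- move=> i E FE.
  have [Mf HMf] := ex_joint HAcompact lam (HF i) mpure.
  have [Mg HMg] := ex_joint HAcompact lam (HF i) gB'.
  have [mh inth uh] := Hh i.
  rewrite /payoff (payoff_joint Hmarg (HF i) (mu i) inth uh mpure HMf FE).
  rewrite (payoff_joint Hmarg (HF i) (mu i) inth uh gB' HMg FE).
  (* Both payoffs integrate the same function, so it suffices that the two joint laws agree, which
     boxes decide. *)
  apply: eq_measure_integral => S mS _.
  apply: (joint_measure_unique HAcompact) mS.
    rewrite HMf.1// (eq_integral (cst 1%E)) => [|t _]; last exact: probability_setT.
    rewrite integral_cst// mul1e (@le_lt_trans _ _ 1%E) ?ltry//.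
    exact: probability_le1.
  move=> B D mB; rewrite measurable_with_salg; last exact: (HF i).1.
  move=> FD; rewrite (joint_box HAcompact Hprod (HF i) mpure HMf)//.
  rewrite (joint_box HAcompact Hprod (HF i) gB' HMg)//.
  (* Each factor integrates over a set of [F j], namely [D] for [j = i] and the whole space
     otherwise, so distribution equivalence applies factor by factor. *)
  apply: eq_bigr => j _; apply: fpure => //; case: dfwithP => // k _.
  rewrite -(measurable_with_salg (HF k).1).
  exact: (@measurableT _ (with_salg (F k))).
- move=> i; exact: (belief_consistent_selection (HF i) (@HAcompact i) (mf i) (gB i) (fE i)).
Qed.
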